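(* Let $s\ge 1$ be an integer and let $z\neq 0$ be a complex number for which the series $A_s(z)=\sum_{m=0}^{\infty}\frac{z^m}{(sm+1)\binom{sm}{m}}$ converges. Suppose that the polynomial $H(X)=1-zX^{s-1}+zX^{s}$ has simple roots, and let $p_{s,1}(z),\dots,p_{s,s}(z)$ be its $s$ complex roots, listed in any order. Then $$A_s(z)=\sum_{m=0}^{\infty}\frac{z^m}{(sm+1)\binom{sm}{m}}=\frac{1}{z}\sum_{k=1}^{s}\frac{\log\left(1-p_{s,k}(z)\right)-\log\left(-p_{s,k}(z)\right)}{p_{s,k}(z)^{s-2}\left(1-s+s\,p_{s,k}(z)\right)}.$$
   Context: $\log$ denotes the principal branch of the complex logarithm, with imaginary part in $(-\pi,\pi]$. $\binom{sm}{m}$ is the usual binomial coefficient. *)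

(* Defs.v *)
(* MathComp-Analysis; the complex field is R[i] over an arbitrary R : realType. *)
From HB Require Import structures.
From mathcomp Require Import all_boot all_order all_algebra.
From mathcomp Require Import all_classical all_reals all_analysis.
From mathcomp Require Import complex.

Set Implicit Arguments.
Unset Strict Implicit.
Unset Printing Implicit Defensive.

Import Order.TTheory GRing.Theory Num.Theory.
Import numFieldNormedType.Exports.

Local Open Scope classical_set_scope.
Local Open Scope ring_scope.
Local Open Scope complex_scope.

(* The library only puts the norm topology on R[i]^o; this makes it available
   on R[i] itself. *)
HB.instance Definition _ (R : realType) := NormedModule.copy R[i] R[i]^o.

(* Principal argument, in ]-pi, pi]; negative reals have argument pi
   (see [carg_itv] and [carg_polar]).  The value at 0 is junk. *)
Definition carg (R : realType) (w : R[i]) : R :=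
  let theta := acos (complex.Re w / Normc.normc w) in
  if 0 <= complex.Im w then theta else - theta.

Definition clog (R : realType) (w : R[i]) : R[i] :=
  ln (Normc.normc w) +i* carg w.

Definition A_term (R : realType) (s : nat) (z : R[i]) (m : nat) : R[i] :=
  z ^+ m / ((s * m + 1)%N%:R * 'C((s * m)%N, m)%:R).

(* [lim] has a junk value unless [series (A_term s z)] converges. *)
Definition A (R : realType) (s : nat) (z : R[i]) : R[i] :=
  lim (series (A_term s z) @ \oo).

Definition Hpoly (R : realType) (s : nat) (z : R[i]) : {poly R[i]} :=
  1 - z *: 'X^(s - 1)%N + z *: 'X^s.

Lemma normc_gt0 (R : realType) (w : R[i]) : w != 0 -> 0 < Normc.normc w.
Proof.
case: w => a b; rewrite eq_complex /= negb_and sqrtr_gt0 => ab.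
rewrite lt_neqAle addr_ge0 ?sqr_ge0// andbT eq_sym paddr_eq0 ?sqr_ge0//.
by rewrite !sqrf_eq0 negb_and.
Qed.

Lemma normc_sqr (R : realType) (w : R[i]) :
  Normc.normc w ^+ 2 = complex.Re w ^+ 2 + complex.Im w ^+ 2.
Proof. by case: w => a b /=; rewrite sqr_sqrtr// addr_ge0 ?sqr_ge0. Qed.

Lemma Re_normc_itv (R : realType) (w : R[i]) : w != 0 ->
  -1 <= complex.Re w / Normc.normc w <= 1.
Proof.
move=> w0; have r0 := normc_gt0 w0.
rewrite -ler_norml normrM normfV (gtr0_norm r0) ler_pdivrMr// mul1r.
rewrite -(@ler_pXn2r _ 2)// ?nnegrE ?normr_ge0 ?(ltW r0)//.
by rewrite real_normK ?num_real// normc_sqr lerDl sqr_ge0.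
Qed.

Lemma carg_itv (R : realType) (w : R[i]) : w != 0 -> - pi < carg w <= pi.
Proof.
move=> w0; have wB := Re_normc_itv w0; rewrite /carg; case: ifPn => [_|].
  rewrite acos_lepi// andbT (lt_le_trans _ (acos_ge0 wB))//.
  by rewrite oppr_lt0 pi_gt0.
rewrite -ltNge => Im0; rewrite ltrN2; apply/andP; split; last first.
  by rewrite (le_trans _ (pi_ge0 R))// oppr_le0 acos_ge0.
apply: acos_ltpi; case/andP: wB => wB ->; rewrite andbT lt_neqAle wB andbT.
apply/negP => /eqP E; have r0 := normc_gt0 w0.
have : complex.Re w = - Normc.normc w.
  by rewrite -(divfK (lt0r_neq0 r0) (complex.Re w)) -E mulN1r.
move=> Ew; have := normc_sqr w; rewrite Ew sqrrN => /eqP.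
by rewrite -subr_eq0 opprD addrA subrr sub0r oppr_eq0 sqrf_eq0 lt_eqF.
Qed.

Lemma carg_polar (R : realType) (w : R[i]) : w != 0 ->
  w = (Normc.normc w * cos (carg w)) +i* (Normc.normc w * sin (carg w)).
Proof.
move=> w0; have wB := Re_normc_itv w0; have r0 := normc_gt0 w0.
have Hs : Normc.normc w * sin (acos (complex.Re w / Normc.normc w)) =
    `|complex.Im w|.
  rewrite sin_acos// -[X in X * _](gtr0_norm r0) -sqrtr_sqr -sqrtrM ?sqr_ge0//.
  rewrite -[RHS]sqrtr_sqr; congr Num.sqrt.
  rewrite mulrBr mulr1 -exprMn mulrC divfK ?lt0r_neq0// normc_sqr.
  by rewrite addrC addKr.
have Hc : Normc.normc w * cos (acos (complex.Re w / Normc.normc w)) =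
    complex.Re w.
  by rewrite acosK ?in_itv//= mulrC divfK ?lt0r_neq0.
rewrite /carg; case: ifPn => [Im0|].
  by rewrite Hc Hs ger0_norm//; case: (w).
by rewrite -ltNge => Im0; rewrite cosN sinN mulrN Hc Hs ltr0_norm// opprK; case: (w).
Qed.

(* Main.v *)
Require Import Defs.
From mathcomp Require Import all_boot all_order all_algebra.
From mathcomp Require Import all_classical all_reals all_analysis.
From mathcomp Require Import complex.
From mathcomp Require Import ring lra zify.

(** The terms are Beta integrals: with [g x = x^(s-1) (1 - x)],
      [1 / ((s m + 1) binom (s m) m) = \int_0^1 (g x)^m dx],
    so that summing the geometric series under the integral sign turns [A s z]
    into [\int_0^1 dx / H(x)], because [H(x) = 1 - z g(x)].  Expanding [1 / H] in
    partial fractions at its simple roots and integrating each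
    [1 / (x - p k)] to [clog (1 - p k) - clog (- p k)] gives the formula; the
    denominators are the values [H'(p k)].  The principal logarithm causes no
    jump, since [x - p k] moves along a horizontal segment that avoids [0],
    hence either misses the real axis or stays on one side of [0] on it.

    Two points need the convergence of the series.

    First, [H] has no root on [[0, 1]] ([A_cvg_no_root01]).  At such a root [x],
    [z = 1 / g x] is a positive real, and the binomial theorem gives
    [binom (s m) m (g x)^m <= 1]; the terms are then at least [1 / (s m + 1)],
    and the series dominates a multiple of the harmonic series.

    Second, the interchange of sum and integral is exact up to a remainder that
    is controlled by the terms themselves ([log_remainder]): the [n]-th partial
    sum misses the integral by [\int_0^1 (z g)^n / H], whose modulus is at most
    a constant times [|z|^n \int_0^1 g^n], that is a constant times the modulus
    of the [n]-th term.  That term tends to [0] because the series converges,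
    which settles the boundary of the disc of convergence along with its
    interior.

    Integrals are only used through primitives.  The functions [g^m] have
    polynomial primitives ([beta_primitive]), [1 / H] has a primitive made of
    logarithms ([cderiv_clog]), and the bound on the remainder is the mean value
    inequality [normc_increment_le]. *)

Set Implicit Arguments.
Unset Strict Implicit.
Unset Printing Implicit Defensive.

Import Order.TTheory GRing.Theory Num.Theory.
Import numFieldNormedType.Exports.

Local Open Scope classical_set_scope.
Local Open Scope ring_scope.

(** * The Beta integral and binomial coefficients *)

(** The Euler Beta integral, in the form of a polynomial primitive.  The
    induction on [b] is integration by parts: the derivative of
    [X^(a+1) (1 - X)^(b+1)] is
    [(a+1) X^a (1 - X)^(b+1) - (b+1) X^(a+1) (1 - X)^b]. *)
Lemma beta_primitive (F : numFieldType) (a b : nat) :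
  exists Q : {poly F}, Q^`() = 'X^a * (1 - 'X) ^+ b /\
    Q.[1] - Q.[0] = (a`! * b`!)%:R / ((a + b).+1)`!%:R.
Proof.
elim: b a => [|b IH] a.
  exists ((a.+1%:R^-1)%:P * 'X^(a.+1)).
  split; last first.
    rewrite !hornerE expr1n expr0n /= mulr0 subr0 mulr1 ?addn0 ?fact0 ?muln1 factS natrM.
    have ? : (a`!%:R : F) != 0 by rewrite pnatr_eq0 -lt0n fact_gt0.
    have ? : (a.+1%:R : F) != 0 by rewrite pnatr_eq0.
    by field; apply/andP.
  rewrite derivM derivC mul0r add0r derivXn /= expr0 mulr1.
  by rewrite -[X in _ * X]mulr_natl mulrA -polyC_natr -polyCM mulVf ?pnatr_eq0// mul1r.
have [Q [dQ Q01]] := IH a.+1.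
exists ((a.+1%:R^-1)%:P * ('X^(a.+1) * (1 - 'X) ^+ b.+1 + b.+1%:R%:P * Q)).
have a0 : (a.+1%:R : F) != 0 by rewrite pnatr_eq0.
split.
  have -> : ('X^a * (1 - 'X) ^+ b.+1 : {poly F}) =
    (a.+1%:R^-1)%:P * (a.+1%:R%:P * ('X^a * (1 - 'X) ^+ b.+1)).
    by rewrite [RHS]mulrA -polyCM mulVf// mul1r.
  rewrite derivM derivC mul0r add0r; congr (_ * _).
  rewrite derivD !derivM derivXn deriv_exp derivB derivC derivX dQ derivC.
  rewrite !polyC_natr /= exprS; ring.
(* Naming the right-hand side protects its factorials from simplification. *)
set r := (X in _ = X).
rewrite !hornerE expr1n subrr !expr0n !mulr0 !mul0r ?add0r ?addr0 ?mul1r.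
rewrite -!mulrBr Q01 /r addSn addnS.
have : ((a + b).+2`!%:R : F) != 0 by rewrite pnatr_eq0 -lt0n fact_gt0.
move: (a + b).+2`! => M M0; rewrite [b.+1`!]factS [a.+1`!]factS !natrM.
by move: (a.+1) a0 => u u0; field; rewrite u0 M0.
Qed.

Lemma beta_binE (F : numFieldType) (s m : nat) : (1 <= s)%N ->
  ((s.-1 * m)`! * m`!)%:R / ((s.-1 * m + m).+1)`!%:R =
  ((s * m + 1)%N%:R * 'C((s * m)%N, m)%:R)^-1 :> F.
Proof.
move=> s1; have E : (s.-1 * m + m = s * m)%N by rewrite -mulSnr prednK.
have le_m : (m <= s * m)%N by rewrite leq_pmull.
have := bin_fact le_m; rewrite -E addnK => bf.
rewrite E factS -E -bf !natrM addn1.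
have ? : ((s.-1 * m)`!%:R : F) != 0 by rewrite pnatr_eq0 -lt0n fact_gt0.
have ? : (m`!%:R : F) != 0 by rewrite pnatr_eq0 -lt0n fact_gt0.
have ? : ('C(s.-1 * m + m, m)%:R : F) != 0.
  by rewrite pnatr_eq0 -lt0n bin_gt0 leq_addl.
have ? : ((s.-1 * m + m).+1%:R : F) != 0 by rewrite pnatr_eq0.
by field; apply/and4P.
Qed.

(** The left-hand side is one term of the expansion of [(x + (1 - x))^n]. *)
Lemma bin_term_le1 (F : realFieldType) (n k : nat) (x : F) : (k <= n)%N ->
  0 <= x <= 1 -> 'C(n, k)%:R * (x ^+ (n - k) * (1 - x) ^+ k) <= 1.
Proof.
move=> kn /andP[x0 x1]; have y0 : 0 <= 1 - x by rewrite subr_ge0.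
have := exprDn x (1 - x) n; rewrite subrKC expr1n => E; rewrite [leRHS]E.
have kn' : (k < n.+1)%N by rewrite ltnS.
rewrite (bigD1 (Ordinal kn'))//= mulr_natl lerDl sumr_ge0// => i _.
by rewrite mulrn_wge0// mulr_ge0// exprn_ge0.
Qed.

(** * Partial fractions *)

(** Lagrange interpolation of the constant [1] at the points [p k]; the
    condition [1 <= s] ensures that [1] has degree less than [s]. *)
Lemma partial_fractions (F : fieldType) (s : nat) (p : 'I_s -> F) (x : F) :
  (1 <= s)%N -> injective p -> (forall k, x != p k) ->
  (\prod_(k < s) (x - p k))^-1 =
  \sum_(k < s) (x - p k)^-1 / \prod_(j < s | j != k) (p k - p j).
Proof.
move=> s1 pinj xp.
pose W k := \prod_(j < s | j != k) (p k - p j).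
have W0 k : W k != 0.
  rewrite prodf_seq_neq0; apply/allP => j _; apply/implyP => jk.
  by rewrite subr_eq0; apply: contra jk => /eqP /pinj ->.
pose L := \sum_(k < s) (W k)^-1 *: \prod_(j < s | j != k) ('X - (p j)%:P).
have LE : L = 1.
  apply/eqP; rewrite -subr_eq0; apply/negPn/negP => nz.
  have := @max_poly_roots _ (L - 1) (codom p) nz.
  rewrite size_codom card_ord.
  have -> : all (root (L - 1)) (codom p).
    apply/allP => _ /codomP[i ->]; rewrite /root !hornerE.
    rewrite horner_sum (bigD1 i)//= hornerZ horner_prod [X in _ + X - _]big1 ?addr0.
      rewrite (eq_bigr (fun j => p i - p j)); last by move=> j _; rewrite !hornerE.
      by rewrite mulVf ?W0// subrr.
    move=> j ji; rewrite hornerZ horner_prod (bigD1 i) 1?eq_sym//=.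
    by rewrite hornerXsubC subrr mul0r mulr0.
  have -> : uniq (codom p) by apply/injectiveP.
  move=> /(_ isT isT); apply/negP; rewrite -leqNgt.
  rewrite (leq_trans (size_polyD _ _))// geq_max size_polyN size_polyC oner_eq0 s1 andbT.
  apply: (leq_trans (size_sum _ _ _)); apply/bigmax_leqP => k _.
  apply: (leq_trans (size_scale_leq _ _)).
  rewrite -big_filter size_prod_XsubC -cardE.
  by have := cardC1 k; rewrite card_ord => ->; rewrite prednK.
have : L.[x] = 1 by rewrite LE hornerE.
rewrite horner_sum => E.
have P0 : \prod_(k < s) (x - p k) != 0.
  by rewrite prodf_seq_neq0; apply/allP => j _; rewrite subr_eq0 xp.
apply: (mulfI P0); rewrite mulfV// -[LHS]E mulr_sumr; apply: eq_bigr => k _.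
rewrite hornerZ horner_prod [in RHS](bigD1 k)//= -/(W k).
under eq_bigr do rewrite hornerXsubC.
by rewrite mulrC mulrA; congr (_ / _); rewrite mulrAC mulfV ?subr_eq0// mul1r.
Qed.

(** * Moduli, real and imaginary parts *)

Lemma ReD (R : realType) (u v : R[i]) :
  complex.Re (u + v) = complex.Re u + complex.Re v.
Proof. by case: u v => [? ?] [? ?]. Qed.

Lemma ImD (R : realType) (u v : R[i]) :
  complex.Im (u + v) = complex.Im u + complex.Im v.
Proof. by case: u v => [? ?] [? ?]. Qed.

Lemma ReN (R : realType) (u : R[i]) : complex.Re (- u) = - complex.Re u.
Proof. by case: u. Qed.

Lemma ImN (R : realType) (u : R[i]) : complex.Im (- u) = - complex.Im u.
Proof. by case: u. Qed.

Lemma normc_ge0 (R : realType) (w : R[i]) : 0 <= Normc.normc w.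
Proof. by case: w => a b; exact: sqrtr_ge0. Qed.

Lemma normc_le_ReIm (R : realType) (w : R[i]) :
  Normc.normc w <= `|complex.Re w| + `|complex.Im w|.
Proof.
rewrite -(@ler_pXn2r _ 2)// ?nnegrE ?addr_ge0 ?normc_ge0//.
rewrite normc_sqr sqrrD !real_normK ?num_real//.
have : 0 <= `|complex.Re w| * `|complex.Im w| by rewrite mulr_ge0.
by rewrite mulr2n; lra.
Qed.

Lemma Re_le_normc (R : realType) (w : R[i]) : `|complex.Re w| <= Normc.normc w.
Proof.
rewrite -(@ler_pXn2r _ 2)// ?nnegrE ?normc_ge0//.
by rewrite normc_sqr real_normK ?num_real// lerDl sqr_ge0.
Qed.

Lemma Im_le_normc (R : realType) (w : R[i]) : `|complex.Im w| <= Normc.normc w.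
Proof.
rewrite -(@ler_pXn2r _ 2)// ?nnegrE ?normc_ge0//.
by rewrite normc_sqr real_normK ?num_real// lerDr sqr_ge0.
Qed.

Lemma normc_real (R : realType) (x : R) : Normc.normc (x%:C%C) = `|x|.
Proof. by rewrite /= expr0n addr0 sqrtr_sqr. Qed.

Lemma normcX (R : realType) (w : R[i]) n :
  Normc.normc (w ^+ n) = Normc.normc w ^+ n.
Proof.
by elim: n => [|n IH]; rewrite ?expr0 ?Normc.normc1// !exprS Normc.normcM IH.
Qed.

(** * Derivatives along the real line *)

(** Derivative of a complex function of a real variable.  It is taken
    componentwise because [R[i]] is a normed module over [R[i]], not over [R]. *)
Definition cderiv (R : realType) (F : R -> R[i]) (x : R) (l : R[i]) : Prop :=
  is_derive x 1 (fun t => complex.Re (F t)) (complex.Re l) /\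
  is_derive x 1 (fun t => complex.Im (F t)) (complex.Im l).

Lemma cderivD (R : realType) (F G : R -> R[i]) (x : R) (l m : R[i]) :
  cderiv F x l -> cderiv G x m -> cderiv (fun t => F t + G t) x (l + m).
Proof.
move=> [Fr Fi] [Gr Gi]; split.
  by rewrite (_ : (fun t => _) = (fun t => complex.Re (F t)) \+
    (fun t => complex.Re (G t))) ?ReD; [exact: is_deriveD|apply/funext => t; rewrite ReD].
by rewrite (_ : (fun t => _) = (fun t => complex.Im (F t)) \+
    (fun t => complex.Im (G t))) ?ImD; [exact: is_deriveD|apply/funext => t; rewrite ImD].
Qed.

Lemma cderivZ (R : realType) (c : R[i]) (F : R -> R[i]) (x : R) (l : R[i]) :
  cderiv F x l -> cderiv (fun t => c * F t) x (c * l).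
Proof.
case: c => a b [Fr Fi]; split.
  rewrite (_ : (fun t => _) = (a \*: (fun t => complex.Re (F t))) \-
    (b \*: (fun t => complex.Im (F t)))); last first.
    by apply/funext => t /=; case: (F t).
  by case: l Fr Fi => ? ? /= Fr Fi; apply: is_deriveB.
rewrite (_ : (fun t => _) = (a \*: (fun t => complex.Im (F t))) \+
    (b \*: (fun t => complex.Re (F t)))); last first.
  by apply/funext => t /=; case: (F t).
by case: l Fr Fi => ? ? /= Fr Fi; apply: is_deriveD.
Qed.

Lemma cderiv_sum (R : realType) (I : Type) (r : seq I) (F : I -> R -> R[i])
    (l : I -> R[i]) (x : R) :
  (forall i, cderiv (F i) x (l i)) ->
  cderiv (fun t => \sum_(i <- r) F i t) x (\sum_(i <- r) l i).
Proof.
move=> dF; elim: r => [|i r IH].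
  rewrite big_nil (_ : (fun t => _) = cst 0).
    by split => /=; exact: is_derive_cst.
  by apply/funext => t; rewrite big_nil.
rewrite big_cons (_ : (fun t => _) = (fun t => F i t + \sum_(j <- r) F j t)).
  exact: cderivD.
by apply/funext => t; rewrite big_cons.
Qed.

Lemma cderiv_real (R : realType) (f : R -> R) (x d : R) :
  is_derive x 1 f d -> cderiv (fun t => (f t)%:C%C) x (d%:C)%C.
Proof. by move=> df; split => //=; exact: is_derive_cst. Qed.

Lemma is_derive_horner (R : realType) (p : {poly R}) (x : R) :
  is_derive x 1 (horner p) (p^`()%R).[x].
Proof.
apply: DeriveDef; first exact: derivable_horner.
by rewrite -derive1E -derivE.
Qed.

(** The mean value theorem, applied to [g - f]. *)
Lemma le_increment (R : realType) (f g df dg : R -> R) :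
  (forall x : R, 0 <= x <= 1 -> is_derive x 1 f (df x)) ->
  (forall x : R, 0 <= x <= 1 -> is_derive x 1 g (dg x)) ->
  (forall x : R, 0 <= x <= 1 -> df x <= dg x) ->
  f 1 - f 0 <= g 1 - g 0.
Proof.
move=> Df Dg dfg; rewrite -subr_ge0.
have D (x : R) : 0 <= x <= 1 -> is_derive x 1 (g \- f) (dg x - df x).
  by move=> x01; apply: is_deriveB; [exact: Dg|exact: Df].
have [||c] := @MVT _ (g \- f) (fun x => dg x - df x) 0 1 ltr01.
- move=> x; rewrite in_itv/= => /andP[x0 x1]; apply: D.
  by rewrite (ltW x0) (ltW x1).
- apply: derivable_within_continuous => x; rewrite in_itv/= => x01.
  by have [] := D x x01.
rewrite in_itv/= => /andP[c0 c1] /=.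
have := dfg c; rewrite (ltW c0) (ltW c1) subr0 mulr1 => /(_ isT).
rewrite -subr_ge0 => h E; rewrite (_ : _ - _ = dg c - df c)// -E; ring.
Qed.

Lemma le_norm_increment (R : realType) (f g df dg : R -> R) :
  (forall x : R, 0 <= x <= 1 -> is_derive x 1 f (df x)) ->
  (forall x : R, 0 <= x <= 1 -> is_derive x 1 g (dg x)) ->
  (forall x : R, 0 <= x <= 1 -> `|df x| <= dg x) ->
  `|f 1 - f 0| <= g 1 - g 0.
Proof.
move=> Df Dg dfg; rewrite ler_norml lerNl opprB; apply/andP; split; last first.
  by apply: (le_increment Df Dg) => x /dfg; apply: le_trans; exact: ler_norm.
have DNf (x : R) : 0 <= x <= 1 -> is_derive x 1 (fun t => - f t) (- df x).
  by move=> /Df ?; apply: is_deriveN.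
have := le_increment DNf Dg; rewrite opprK addrC; apply=> x /dfg.
by apply: le_trans; rewrite -normrN ler_norm.
Qed.

(** Mean value inequality.  The factor [2] comes from estimating the real and
    the imaginary parts separately. *)
Lemma normc_increment_le (R : realType) (F dF : R -> R[i]) (g dg : R -> R) :
  (forall x : R, 0 <= x <= 1 -> cderiv F x (dF x)) ->
  (forall x : R, 0 <= x <= 1 -> is_derive x 1 g (dg x)) ->
  (forall x : R, 0 <= x <= 1 -> Normc.normc (dF x) <= dg x) ->
  Normc.normc (F 1 - F 0) <= 2 * (g 1 - g 0).
Proof.
move=> DF Dg dFg.
apply: (le_trans (normc_le_ReIm _)); rewrite mulr_natl mulr2n lerD//.
  rewrite ReD ReN.
  apply: (@le_norm_increment _ (fun t => complex.Re (F t)) g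
    (fun t => complex.Re (dF t)) dg) => // x x01.
    by case: (DF x x01).
  exact: le_trans (Re_le_normc _) (dFg _ x01).
rewrite ImD ImN.
apply: (@le_norm_increment _ (fun t => complex.Im (F t)) g
    (fun t => complex.Im (dF t)) dg) => // x x01.
  by case: (DF x x01).
exact: le_trans (Im_le_normc _) (dFg _ x01).
Qed.

(** * The derivative of the principal logarithm *)

(** On the upper half-plane this replaces the arc cosine of [carg] by a function
    whose derivative is rational. *)
Lemma acos_div_atan (R : realType) (u v : R) : 0 < v ->
  acos (u / Num.sqrt (u ^+ 2 + v ^+ 2)) = pi / 2 - atan (u / v).
Proof.
move=> v0.
have -> : u / Num.sqrt (u ^+ 2 + v ^+ 2) = cos (pi / 2 - atan (u / v)).
  rewrite -opprB cosN cosBpihalf -[RHS](divfK (lt0r_neq0 (_ : 0 < cos (atan (u / v))))).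
    rewrite -/(tan _) atanK cos_atan.
    have -> : u ^+ 2 + v ^+ 2 = v ^+ 2 * (1 + (u / v) ^+ 2).
      by field; rewrite gt_eqF.
    by rewrite sqrtrM ?sqr_ge0// sqrtr_sqr gtr0_norm// invfM mulrA.
  by apply: cos_gt0_pihalf; rewrite atan_gtNpi2 atan_ltpi2.
rewrite cosK// in_itv/=.
by have := atan_gtNpi2 (u / v); have := atan_ltpi2 (u / v); lra.
Qed.

Lemma carg_atan (R : realType) (u v : R) : v != 0 ->
  carg (u +i* v)%C = Num.sg v * (pi / 2) - atan (u / v).
Proof.
move=> v0; rewrite /carg /=; case: ifPn => [v_ge0|].
  have vp : 0 < v by rewrite lt_neqAle eq_sym v0.
  by rewrite acos_div_atan// gtr0_sg// mul1r.
rewrite -ltNge => vn; rewrite -[v ^+ 2]sqrrN acos_div_atan ?oppr_gt0//.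
by rewrite ltr0_sg// invrN mulrN atanN mulN1r opprD opprK.
Qed.

(** On the real axis the argument is [0] or [pi], hence locally constant away
    from the origin. *)
Lemma carg_real_near (R : realType) (a x : R) : x != a ->
  \forall t \near x, carg ((x - a) +i* 0)%C = carg ((t - a) +i* 0)%C.
Proof.
have cst (u : R) : u != 0 -> carg (u +i* 0)%C = acos (Num.sg u).
  move=> u0; rewrite /carg /= lexx expr0n addr0 sqrtr_sqr; congr acos.
  by rewrite [X in X / _]numEsg mulfK// normr_eq0.
rewrite neq_lt => /orP[xa|ax].
  near=> t; have ta : t < a by near: t; exact: lt_nbhsl.
  by rewrite !cst ?subr_eq0 ?lt_eqF// !ltr0_sg ?subr_lt0.
near=> t; have ta : a < t by near: t; exact: lt_nbhsr.
by rewrite !cst ?subr_eq0 ?gt_eqF// !gtr0_sg ?subr_gt0.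
Unshelve. all: by end_near. Qed.

(** Removing the square root makes the left-hand side easy to differentiate.
    The identity holds at [w = 0] because [ln 0 = 0]. *)
Lemma ln_normc (R : realType) (w : R[i]) :
  ln (Normc.normc w) = 2^-1 * ln (complex.Re w ^+ 2 + complex.Im w ^+ 2).
Proof.
have [->|w0] := eqVneq w 0.
  by rewrite Normc.normc0 /= expr0n addr0 ln0// mulr0.
by rewrite -normc_sqr lnXn ?normc_gt0// -[X in _ * X]mulr_natl mulKf ?pnatr_eq0.
Qed.

(** No branch condition is needed: as [t] varies, [t - p] moves parallel to the
    real axis, so it never crosses the branch cut. *)
Lemma cderiv_clog (R : realType) (p : R[i]) (x : R) : x%:C%C != p ->
  cderiv (fun t => clog (t%:C%C - p)) x (x%:C%C - p)^-1.
Proof.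
case: p => a b; rewrite eq_complex /= => xp.
have wE (t : R) : t%:C%C - (a +i* b)%C = ((t - a) +i* - b)%C.
  by rewrite /real_complex_def; congr Complex => /=; rewrite sub0r.
have y0 : 0 < (x - a) ^+ 2 + (- b) ^+ 2.
  rewrite sqrrN lt_neqAle eq_sym addr_ge0 ?sqr_ge0// andbT.
  rewrite paddr_eq0 ?sqr_ge0// !sqrf_eq0 subr_eq0.
  by rewrite [b == 0]eq_sym.
rewrite wE (_ : (fun t => _) = (fun t => clog ((t - a) +i* (- b))%C)); last first.
  by apply/funext => t; rewrite wE.
split.
  rewrite (_ : (fun t => _) =
      2^-1 \*: ((@ln R) \o (fun t => (t - a) ^+ 2 + (- b) ^+ 2))); last first.
    by apply/funext => t; rewrite /clog [LHS]ln_normc.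
  have d1 : is_derive x 1 (fun t : R => (t - a) ^+ 2 + (- b) ^+ 2)
      (2 * (x - a)).
    by apply: is_derive_eq; rewrite /GRing.scale /=; ring.
  have d2 := @is_derive1_comp _ (@ln R) _ x _ _ (is_derive1_ln y0) d1.
  apply: (is_derive_eq (is_deriveZ 2^-1 d2)).
  rewrite /GRing.scale /=; field; exact: lt0r_neq0.
rewrite /clog.
have [b0|b0] := eqVneq b 0.
  rewrite b0 oppr0 (_ : complex.Im _ = 0); last by rewrite /= mul0r oppr0.
  apply: (@near_eq_is_derive _ _ _ (cst (carg ((x - a) +i* 0)%C))).
  rewrite b0 eqxx andbT in xp.
  by have := carg_real_near xp; apply: filterS => t ->.
have nb0 : - b != 0 by rewrite oppr_eq0.
rewrite (_ : (fun t => _) = (cst (Num.sg (- b) * (pi / 2)) \-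
   (atan \o (fun t => (t - a) * (- b)^-1)))); last first.
  by apply/funext => t; rewrite /= carg_atan.
have d1 : is_derive x 1 (fun t : R => (t - a) * (- b)^-1) (- b)^-1.
  by apply: is_derive_eq; rewrite /GRing.scale /=; ring.
have d2 := @is_derive1_comp _ (@atan R) (fun t : R => (t - a) * (- b)^-1) x _ _
  (is_derive1_atan _) d1.
apply: (is_derive_eq (is_deriveB (is_derive_cst _ _ _) d2)).
rewrite sub0r [RHS]/=; have := lt0r_neq0 y0; rewrite sqrrN => y1.
by field; rewrite y1 b0.
Qed.

(** * The polynomial and its roots *)

Lemma HpolyE (R : realType) (s : nat) (z x : R[i]) : (1 <= s)%N ->
  (Hpoly s z).[x] = 1 - z * (x ^+ s.-1 * (1 - x)).
Proof.
case: s => // n _; rewrite /Hpoly subn1 /=.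
by rewrite !(hornerD, hornerN, hornerZ, hornerXn, hornerC) exprS; ring.
Qed.

Lemma lead_coef_Hpoly (R : realType) (s : nat) (z : R[i]) :
  (1 <= s)%N -> z != 0 -> lead_coef (Hpoly s z) = z.
Proof.
move=> s1 z0; rewrite /Hpoly lead_coefDr ?lead_coefZ ?lead_coefXn ?mulr1//.
rewrite size_scale// size_polyXn ltnS (leq_trans (size_polyD _ _))//.
rewrite geq_max size_polyC oner_eq0 s1 size_polyN.
by rewrite (leq_trans (size_scale_leq _ _))// size_polyXn subn1 prednK.
Qed.

Lemma Hpoly_derivE (R : realType) (s : nat) (z x : R[i]) :
  (1 <= s)%N -> x != 0 ->
  (Hpoly s z)^`().[x] = z * (x ^ (s%:Z - 2) * (1 - s%:R + s%:R * x)).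
Proof.
case: s => // n _ x0; rewrite /Hpoly subn1 /= derivD derivB derivZ derivC.
rewrite derivZ !derivXn
  !(hornerD, hornerN, hornerZ, hornerMn, hornerXn, hornerC).
case: n => [|n] /=.
  rewrite (_ : 1%N%:Z - 2 = -1)// exprN1.
  by rewrite mulr0n expr0; field.
rewrite (_ : n.+2%:Z - 2 = n%:Z); last by lia.
by rewrite -exprnP exprS; ring.
Qed.

Lemma Hpoly_horner_prod (R : realType) (s : nat) (z : R[i]) (p : 'I_s -> R[i]) x :
  Hpoly s z = z *: \prod_(k < s) ('X - (p k)%:P) ->
  (Hpoly s z).[x] = z * \prod_(k < s) (x - p k).
Proof.
move=> HE; rewrite HE hornerZ horner_prod; congr (_ * _).
by apply: eq_bigr => k _; rewrite hornerXsubC.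
Qed.

Lemma Hpoly_root (R : realType) (s : nat) (z : R[i]) (p : 'I_s -> R[i]) k :
  Hpoly s z = z *: \prod_(k < s) ('X - (p k)%:P) ->
  (Hpoly s z).[p k] = 0.
Proof.
by move=> /Hpoly_horner_prod ->; rewrite (bigD1 k)//= subrr mul0r mulr0.
Qed.

Lemma simple_roots_inj (R : realType) (s : nat) (z : R[i]) (p : 'I_s -> R[i]) :
  (1 <= s)%N -> z != 0 ->
  Hpoly s z = z *: \prod_(k < s) ('X - (p k)%:P) ->
  (forall x : R[i], root (Hpoly s z) x -> mup x (Hpoly s z) = 1%N) ->
  injective p.
Proof.
move=> s1 z0 HE Hs i j pij; apply/eqP/negPn/negP => ij.
have H0 : Hpoly s z != 0 by rewrite -lead_coef_eq0 lead_coef_Hpoly.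
have : (2 <= mup (p i) (Hpoly s z))%N.
  rewrite mup_geq// HE (bigD1 i)//= (bigD1 j) 1?eq_sym//= -pij.
  by rewrite mulrA -expr2 -mul_polyC dvdp_mull// dvdp_mulIl.
by rewrite Hs// /root (Hpoly_root i HE).
Qed.

(** Both sides, multiplied by [z], are the derivative of [Hpoly s z] at [p k]. *)
Lemma root_weightE (R : realType) (s : nat) (z : R[i]) (p : 'I_s -> R[i]) k :
  (1 <= s)%N -> z != 0 ->
  Hpoly s z = z *: \prod_(k < s) ('X - (p k)%:P) -> p k != 0 ->
  \prod_(j < s | j != k) (p k - p j) =
  p k ^ (s%:Z - 2) * (1 - s%:R + s%:R * p k).
Proof.
move=> s1 z0 HE pk0; apply: (mulfI z0); rewrite -Hpoly_derivE//.
rewrite HE derivZ hornerZ [in RHS](bigD1 k)//= derivM derivXsubC mul1r.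
rewrite hornerD hornerM hornerXsubC subrr mul0r addr0 horner_prod.
by congr (_ * _); apply: eq_bigr => j _; rewrite hornerXsubC.
Qed.

(** * Consequences of convergence *)

Lemma A_termE (R : realType) (s : nat) (z : R[i]) (m : nat) :
  A_term s z m = z ^+ m *
    (((s * m + 1)%N%:R * 'C((s * m)%N, m)%:R)^-1 : R)%:C%C.
Proof. by rewrite /A_term fmorphV rmorphM !rmorph_nat. Qed.

Lemma cvg_Re (R : realType) (u : nat -> R[i]) (l : R[i]) :
  u @ \oo --> l -> (fun n => complex.Re (u n)) @ \oo --> complex.Re l.
Proof.
move=> /cvgrPdist_lt ul; apply/cvgrPdist_lt => e e0.
have e0' : 0 < e%:C%C by rewrite ltcR.
apply: filterS (ul _ e0') => n; rewrite normc_def -(normc_def) => h.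
have -> : complex.Re l - complex.Re (u n) = complex.Re (l - u n).
  by case: (l) (u n) => [? ?] [? ?].
by rewrite -ltcR (le_lt_trans (normc_ge_Re _)).
Qed.

(** A root [x] in [[0, 1]] forces [z = 1 / g] with [g = x^(s-1) (1 - x) > 0];
    by [bin_term_le1] the [m]-th term is then at least [1 / (s m + 1)], and the
    harmonic series would converge. *)
Lemma A_cvg_no_root01 (R : realType) (s : nat) (z : R[i]) (x : R) :
  (1 <= s)%N -> cvg (series (A_term s z) @ \oo) -> 0 <= x <= 1 ->
  (Hpoly s z).[x%:C%C] != 0.
Proof.
move=> s1 /cvg_ex[l Al] x01; rewrite HpolyE//; apply/negP => /eqP.
set g := x ^+ s.-1 * (1 - x).
have -> : (x%:C ^+ s.-1 * (1 - x%:C) = g%:C)%C.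
  by rewrite /g rmorphM rmorphXn rmorphB rmorph1.
move=> /eqP; rewrite subr_eq0 => /eqP zg.
have g0 : g != 0.
  by apply/eqP => g0; move: zg; rewrite g0 rmorph0 mulr0 => /eqP; rewrite oner_eq0.
have gp : 0 < g.
  rewrite lt_neqAle eq_sym g0 /g; case/andP: x01 => x0 x1.
  by rewrite mulr_ge0 ?exprn_ge0// subr_ge0.
have zE : z = (g^-1)%:C%C.
  by apply: (mulIf (_ : g%:C%C != 0)); rewrite ?fmorph_eq0// -zg -rmorphM mulVf.
pose b m : R := g^-1 ^+ m * ((s * m + 1)%N%:R * 'C((s * m)%N, m)%:R)^-1.
have bge m : harmonic m <= s%:R * b m.
  have C0 : 0 < ('C((s * m)%N, m)%:R : R) by rewrite ltr0n bin_gt0 leq_pmull.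
  have N0 : 0 < ((s * m + 1)%N%:R : R) by rewrite ltr0n addn1.
  have S0 : 0 < (s%:R : R) by rewrite ltr0n.
  have := @bin_term_le1 R (s * m) m x (leq_pmull _ s1) x01.
  have -> : x ^+ (s * m - m) * (1 - x) ^+ m = g ^+ m.
    by rewrite /g exprMn -exprM; congr (x ^+ _ * _);
      case: (s) s1 => // n _; rewrite mulSn addKn.
  move=> h; rewrite /b /harmonic /= exprVn -!invfM.
  rewrite ler_pdivlMr ?mulr_gt0 ?exprn_gt0//.
  have M0 : 0 < (m.+1%:R : R) by rewrite ltr0n.
  rewrite mulrC ler_pdivrMr//.
  have h2 : (s * m + 1)%N%:R <= (s%:R * m.+1%:R : R) by rewrite -natrM ler_nat; lia.
  apply: le_trans h2; rewrite mulrCA ger_pMr//.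
  by rewrite mulrC.
have Ab m : complex.Re (A_term s z m) = b m.
  by rewrite A_termE zE -rmorphXn -rmorphM.
have bs : (fun n => complex.Re (series (A_term s z) n)) = series b.
  apply/funext => n; rewrite /series /=.
  elim: n => [|n IH]; first by rewrite !big_nil.
  by rewrite !big_nat_recr//= ReD IH Ab.
have := cvg_Re Al; rewrite bs => cb.
apply: (@dvg_harmonic R).
apply: (@series_le_cvg _ _ (fun m => s%:R * b m)) => //.
- by move=> m; exact: harmonic_ge0.
- by move=> m; rewrite (le_trans (harmonic_ge0 m))//.
- have /is_cvg_seriesZ - /(_ (s%:R : R)) : cvgn (series b).
    by apply/cvg_ex; exists (complex.Re l).
  exact.
Qed.

Lemma cvg_of_normc_le (R : realType) (u v : nat -> R[i]) (l : R[i]) (K : R) :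
  0 < K -> (forall n, Normc.normc (l - u n) <= K * Normc.normc (v n)) ->
  v @ \oo --> (0 : R[i]) -> u @ \oo --> l.
Proof.
move=> K0 uv /cvgr0Pnorm_lt v0; apply/cvgrPdist_lt => e e0.
have KC : 0 < K%:C%C by rewrite ltcR.
apply: filterS (v0 _ (divr_gt0 e0 KC)) => n.
rewrite ltr_pdivlMr// => /(le_lt_trans _); apply.
rewrite mulrC.
change ((Normc.normc (l - u n))%:C%C <= K%:C%C * (Normc.normc (v n))%:C%C).
by rewrite -rmorphM lecR.
Qed.

(** * The integral of the reciprocal of the polynomial *)

(** The squared modulus of [Hpoly s z] on the real line is a real polynomial, so
    it attains its minimum on [[0, 1]]. *)
Lemma Hpoly_lower_bound (R : realType) (s : nat) (z : R[i]) : (1 <= s)%N ->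
  (forall x : R, 0 <= x <= 1 -> (Hpoly s z).[x%:C%C] != 0) ->
  exists2 c : R, 0 < c & forall x : R, 0 <= x <= 1 ->
    c <= Normc.normc (Hpoly s z).[x%:C%C].
Proof.
move=> s1 H0.
pose g : {poly R} := 'X^(s.-1) * (1 - 'X).
pose N : {poly R} := (1 - complex.Re z *: g) ^+ 2 + (complex.Im z *: g) ^+ 2.
have NE x : N.[x] = Normc.normc (Hpoly s z).[x%:C%C] ^+ 2.
  rewrite HpolyE// (_ : x%:C%C ^+ _ * _ = (g.[x])%:C%C); last first.
    by rewrite /g hornerM hornerXn hornerD hornerN hornerX hornerC
      rmorphM rmorphXn rmorphB rmorph1.
  rewrite normc_sqr /N !(hornerD, horner_exp, hornerN, hornerZ, hornerC).
  by case: (z) => a b /=; ring.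
have [||c c01 cmin] := @EVT_min R (horner N) 0 1; first exact: ler01.
  apply: derivable_within_continuous => x _; exact: derivable_horner.
rewrite in_itv/= in c01.
exists (Num.sqrt N.[c]) => [|x x01].
  by rewrite sqrtr_gt0 NE exprn_gt0// normc_gt0// H0.
have -> : Normc.normc (Hpoly s z).[x%:C%C] = Num.sqrt N.[x].
  by rewrite NE sqrtr_sqr ger0_norm// normc_ge0.
by rewrite ler_sqrt ?cmin ?in_itv//= NE sqr_ge0.
Qed.

(** With [f = z g], the function [F] of the proof is a primitive of
    [1 / H - (1 + f + ... + f^(n-1)) = f^n / H] on [[0, 1]], and its increment
    is the difference to be bounded.  A lower bound [c] for the modulus of [H]
    bounds the derivative by [c^-1 |z|^n g^n], whose primitive increases from
    [0] to [1] by exactly [c^-1] times the modulus of the [n]-th term. *)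
Lemma log_remainder (R : realType) (s : nat) (z : R[i]) (p : 'I_s -> R[i])
    (w : 'I_s -> R[i]) :
  (1 <= s)%N ->
  (forall x : R, 0 <= x <= 1 -> (Hpoly s z).[x%:C%C] != 0) ->
  (forall k (x : R), 0 <= x <= 1 -> x%:C%C != p k) ->
  (forall x : R, 0 <= x <= 1 ->
    ((Hpoly s z).[x%:C%C])^-1 = \sum_(k < s) (x%:C%C - p k)^-1 * w k) ->
  exists2 K : R, 0 < K & forall n, Normc.normc
    (\sum_(k < s) (clog (1 - p k) - clog (- p k)) * w k -
      series (A_term s z) n) <= K * Normc.normc (A_term s z n).
Proof.
move=> s1 H0 xp pf.
have [c c0 cH] := Hpoly_lower_bound s1 H0.
have bP (m : nat) : exists Q : {poly R}, Q^`() = ('X^(s.-1) * (1 - 'X)) ^+ m /\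
    Q.[1] - Q.[0] = ((s * m + 1)%N%:R * 'C((s * m)%N, m)%:R)^-1.
  have [Q [dQ Q01]] := beta_primitive R (s.-1 * m) m; exists Q.
  by rewrite dQ Q01 beta_binE// exprMn -exprM.
have [Q QP] := choice bP.
pose g (x : R) := x ^+ s.-1 * (1 - x).
have dQ m (x : R) : is_derive x 1 (horner (Q m)) (g x ^+ m).
  have [dQ _] := QP m; have := is_derive_horner (Q m) x.
  by rewrite dQ horner_exp !hornerE.
have gE (x : R) : (g x)%:C%C = x%:C%C ^+ s.-1 * (1 - x%:C%C).
  by rewrite /g rmorphM rmorphXn rmorphB rmorph1.
exists (2 * c^-1); first by rewrite mulr_gt0 ?invr_gt0.
move=> n.
pose F (t : R) := \sum_(k < s) w k * clog (t%:C%C - p k) +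
  (-1) * (\sum_(0 <= m < n) z ^+ m * ((Q m).[t])%:C%C).
pose dF (t : R) := \sum_(k < s) w k * (t%:C%C - p k)^-1 +
  (-1) * (\sum_(0 <= m < n) z ^+ m * (g t ^+ m)%:C%C).
have DF (x : R) : 0 <= x <= 1 -> cderiv F x (dF x).
  move=> x01; apply: cderivD.
    by apply: cderiv_sum => k; apply/cderivZ/cderiv_clog/xp.
  apply: cderivZ; apply: cderiv_sum => m; apply: cderivZ.
  exact: (cderiv_real (dQ m x)).
have dFE (x : R) : 0 <= x <= 1 ->
    dF x = (z * (g x)%:C%C) ^+ n / (Hpoly s z).[x%:C%C].
  move=> x01; rewrite /dF.
  under eq_bigr do rewrite mulrC.
  rewrite -pf// mulN1r HpolyE// -gE.
  have h0 := H0 x x01; rewrite HpolyE// -gE in h0.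
  under eq_bigr do rewrite rmorphXn -exprMn.
  rewrite big_mkord; move: (z * _) h0 => f f1.
  have := subrX1 f n; set S := (X in _ = _ * X) => E.
  apply: (mulIf f1); rewrite mulfVK// mulrBl mulVf//.
  have -> : f ^+ n = f ^+ n - 1 + 1 by rewrite subrK.
  by rewrite E -/S; ring.
have DG (x : R) : 0 <= x <= 1 ->
    is_derive x 1 (fun t => c^-1 * Normc.normc z ^+ n * (Q n).[t])
      (c^-1 * Normc.normc z ^+ n * g x ^+ n).
  by move=> _; exact: (is_deriveZ (c^-1 * Normc.normc z ^+ n) (dQ n x)).
have := normc_increment_le DF DG.
have -> : F 1 - F 0 = \sum_(k < s) (clog (1 - p k) - clog (- p k)) * w k -
      series (A_term s z) n.
  have -> : series (A_term s z) n =
     \sum_(0 <= m < n) z ^+ m * ((Q m).[1])%:C%C -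
     \sum_(0 <= m < n) z ^+ m * ((Q m).[0])%:C%C.
    rewrite -sumrB; apply: eq_bigr => m _; rewrite A_termE -mulrBr -rmorphB.
    by have [_ ->] := QP m.
  have -> : \sum_(k < s) (clog (1 - p k) - clog (- p k)) * w k =
     \sum_(k < s) w k * clog (1%:C%C - p k) - \sum_(k < s) w k * clog (0%:C%C - p k).
    by rewrite -sumrB; apply: eq_bigr => k _; rewrite -mulrBr mulrC rmorph1 rmorph0 sub0r.
  by rewrite /F; ring.
move=> /(_ _)/le_trans; apply.
- move=> x x01; rewrite dFE// Normc.normcM Normc.normcV normcX Normc.normcM.
  have gx0 : 0 <= g x.
    by case/andP: x01 => x0 x1; rewrite mulr_ge0 ?exprn_ge0// subr_ge0.
  rewrite normc_real (ger0_norm gx0) exprMn mulrC -mulrA ler_wpM2r//.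
    by rewrite mulr_ge0// exprn_ge0// normc_ge0.
  by rewrite lef_pV2 ?cH// posrE// normc_gt0// H0.
have [_ E] := QP n.
rewrite A_termE Normc.normcM normcX normc_real -mulrBr E -!mulrA.
by rewrite ger0_norm// invr_ge0 mulr_ge0.
Qed.

(** * The formula *)

Theorem theorem1 (R : realType) (s : nat) (z : R[i]) (p : 'I_s -> R[i])
  (s_ge1 : (1 <= s)%N) (z_neq0 : z != 0)
  (A_cvg : cvg (series (A_term s z) @ \oo))
  (H_simple : forall x : R[i], root (Hpoly s z) x -> mup x (Hpoly s z) = 1%N)
  (p_roots : Hpoly s z = lead_coef (Hpoly s z) *: \prod_(k < s) ('X - (p k)%:P)) :
  A s z =
  z^-1 * \sum_(k < s) (clog (1 - p k) - clog (- p k)) /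
                      (p k ^ (s%:Z - 2) * (1 - s%:R + s%:R * p k)).
Proof.
have HE : Hpoly s z = z *: \prod_(k < s) ('X - (p k)%:P).
  by rewrite [LHS]p_roots lead_coef_Hpoly.
have H0 (x : R) : 0 <= x <= 1 -> (Hpoly s z).[x%:C%C] != 0.
  exact: A_cvg_no_root01.
have xp k (x : R) : 0 <= x <= 1 -> x%:C%C != p k.
  by move=> x01; apply: contraNneq (H0 x x01) => ->; rewrite (Hpoly_root k HE).
have pinj : injective p by exact: (simple_roots_inj s_ge1 z_neq0 HE H_simple).
(* [z * W k] is the derivative of [Hpoly s z] at [p k]. *)
pose W k := \prod_(j < s | j != k) (p k - p j).
have WE k : W k = p k ^ (s%:Z - 2) * (1 - s%:R + s%:R * p k).
  apply: (root_weightE s_ge1 z_neq0 HE); rewrite eq_sym.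
  by have := xp k 0; rewrite lexx ler01 rmorph0; apply.
have pf (x : R) : 0 <= x <= 1 -> ((Hpoly s z).[x%:C%C])^-1 =
    \sum_(k < s) (x%:C%C - p k)^-1 * (z * W k)^-1.
  move=> x01; rewrite (Hpoly_horner_prod _ HE) invfM.
  rewrite (@partial_fractions _ s p)// => [|k]; last exact: xp.
  by rewrite mulr_sumr; apply: eq_bigr => k _; rewrite -/(W k) invfM; ring.
have [K K0 HK] := log_remainder s_ge1 H0 xp pf.
apply: cvg_lim; first exact: norm_hausdorff.
apply: (cvg_of_normc_le K0) (cvg_series_cvg_0 A_cvg) => n.
have := HK n; rewrite mulr_sumr.
by under eq_bigr do rewrite invfM mulrCA WE.
Qed.
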